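(* For every $\delta \in (0,1)$ and every $\gamma > 0$, there exists a finite universe $\Omega$ and a family $\mathcal{F}$ of pairs $(P,Q)$ of probability distributions on $\Omega$, each satisfying $d_{\mathrm{TV}}(P,Q) \le \delta$, such that every correlated sampling strategy $(f,g)$ on $\Omega$ has error at least $\frac{2\delta}{1+\delta} - \gamma$ on this family, i.e. there exists $(P,Q) \in \mathcal{F}$ with $\Pr_{r \sim \mathcal{R}}[f(P,r) \neq g(Q,r)] \ge \frac{2\delta}{1+\delta} - \gamma$.
   Context: Let $\Omega$ be a finite universe and $\Delta_\Omega$ the set of probability distributions on $\Omega$. The total variation distance is $d_{\mathrm{TV}}(P,Q) = \frac12 \sum_{\omega \in \Omega} |P(\omega) - Q(\omega)|$. A correlated sampling strategy consists of a probability space $\mathcal{R}$ of shared randomness (of arbitrary size) and functions $f, g : \Delta_\Omega \times \mathcal{R} \to \Omega$ such that for every $P, Q \in \Delta_\Omega$, when $r \sim \mathcal{R}$ the random variable $f(P,r)$ has distribution exactly $P$ and $g(Q,r)$ has distribution exactly $Q$. Its disagreement probability on a pair $(P,Q)$ is $\Pr_{r \sim \mathcal{R}}[f(P,r) \neq g(Q,r)]$. *)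

(* Defs.v *)
From HB Require Import structures.
From mathcomp Require Export all_boot all_order all_algebra.
From mathcomp Require Export all_classical all_reals all_analysis.

Set Implicit Arguments.
Unset Strict Implicit.
Unset Printing Implicit Defensive.

Import Order.TTheory GRing.Theory Num.Theory.

Local Open Scope classical_set_scope.
Local Open Scope ring_scope.

Record fdist (R : realType) (Omega : finType) := FDist {
  fdist_mass :> {ffun Omega -> R};
  fdist_ge0 : forall w, 0 <= fdist_mass w;
  fdist_sum1 : \sum_(w : Omega) fdist_mass w = 1 }.

Definition dTV (R : realType) (Omega : finType) (P Q : fdist R Omega) : R :=
  2^-1 * \sum_(w : Omega) `|P w - Q w|.

(* A finType carries no canonical measurable structure; the first conjunct is
   measurability of X for the discrete sigma-algebra on Omega. *)
Definition has_law (R : realType) (Omega : finType) (d : measure_display)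
    (T : measurableType d) (Pr : probability T R) (X : T -> Omega)
    (P : fdist R Omega) : Prop :=
  (forall A : set Omega, measurable (X @^-1` A)) /\
  (forall w : Omega, Pr [set r | X r = w] = (P w)%:E).

Definition correlated_sampling_strategy (R : realType) (Omega : finType)
    (d : measure_display) (T : measurableType d) (Pr : probability T R)
    (f g : fdist R Omega -> T -> Omega) : Prop :=
  (forall P : fdist R Omega, has_law Pr (f P) P) /\
  (forall Q : fdist R Omega, has_law Pr (g Q) Q).

Definition disagreement (R : realType) (Omega : finType)
    (d : measure_display) (T : measurableType d) (Pr : probability T R)
    (f g : fdist R Omega -> T -> Omega) (P Q : fdist R Omega) : \bar R :=
  Pr [set r | f P r <> g Q r].

(* Main.v *)
Require Import Defs.
From mathcomp Require Import all_boot all_order all_algebra.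
From mathcomp Require Import all_classical all_reals all_analysis.
From mathcomp Require Import measurable_realfun.
From mathcomp Require Import ring lra zify.

(** Let [p] be slightly above [1 - delta].  On the grid ['I_n * 'I_n] take for [P]
    the uniform distributions on unions of [k = p n] rows and for [Q] those on
    unions of [k] columns; any such [P] and [Q] are at distance [1 - k / n].
    Draw the rows and the columns independently and uniformly.  For a fixed value
    of the shared randomness let [F x] be the probability that [f P] is the cell
    [x].  A set [X] of cells meets a random union of rows with probability at most
    about [1 - (1 - p) ^ #|X|], so that [F] is majorized by the geometric
    distribution [p (1 - p) ^ i] and [\sum_x F x ^ 2 <= p / (2 - p)] up to a small
    error; the same holds for [G] defined from [g Q].  By AM-GM the probability
    [\sum_x F x * G x] of agreement is at most about [p / (2 - p)], which is close
    to [(1 - delta) / (1 + delta)], and averaging over the shared randomness yields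
    a pair with at most this probability of agreement. *)

Set Implicit Arguments.
Unset Strict Implicit.
Unset Printing Implicit Defensive.

Import Order.TTheory GRing.Theory Num.Theory.
Import numFieldNormedType.Exports.

Local Open Scope ring_scope.

Section Majorization.
Variable R : realDomainType.
Implicit Types a b d : nat -> R.

Lemma ler_sum_mul_nonincreasing a b d (n : nat) :
  (forall i, 0 <= a i) -> nonincreasing_seq a ->
  (forall j, (j <= n)%N -> \sum_(i < j) b i <= \sum_(i < j) d i) ->
  \sum_(i < n) a i * b i <= \sum_(i < n) a i * d i.
Proof.
move=> a_ge0 a_dec le_bd; rewrite -subr_ge0 -sumrB.
under eq_bigr do rewrite -mulrBr.
have partial_ge0 j : (j <= n)%N -> 0 <= \sum_(i < j) (d i - b i).
  by move=> le_jn; rewrite sumrB subr_ge0 le_bd.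
suff abel j : (j <= n)%N ->
    a j * \sum_(i < j) (d i - b i) <= \sum_(i < j) a i * (d i - b i).
  by apply: le_trans (abel n _) => //; rewrite mulr_ge0 ?partial_ge0.
elim: j => [|j IHj] lt_jn; first by rewrite !big_ord0 mulr0.
apply: (@le_trans _ _ (a j * \sum_(i < j.+1) (d i - b i))).
  by rewrite ler_wpM2r ?partial_ge0 // a_dec.
by rewrite !big_ord_recr /= mulrDr lerD2r IHj // ltnW.
Qed.

Lemma ler_sum_sqr_majorized_seq a d (n : nat) :
  (forall i, 0 <= a i) -> nonincreasing_seq a ->
  (forall i, 0 <= d i) -> nonincreasing_seq d ->
  (forall j, (j <= n)%N -> \sum_(i < j) a i <= \sum_(i < j) d i) ->
  \sum_(i < n) a i ^+ 2 <= \sum_(i < n) d i ^+ 2.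
Proof.
move=> a_ge0 a_dec d_ge0 d_dec le_ad.
apply: (@le_trans _ _ (\sum_(i < n) a i * d i)).
  by under eq_bigr do rewrite expr2; exact: ler_sum_mul_nonincreasing.
under eq_bigr do rewrite mulrC.
by under [leRHS]eq_bigr do rewrite expr2; exact: ler_sum_mul_nonincreasing.
Qed.

Variables (I : finType) (F : I -> R).

Definition decreasing_enum : seq I :=
  sort (fun x y => F y <= F x) (enum I).

Definition rearrangement (i : nat) : R := nth 0 (map F decreasing_enum) i.

Lemma perm_decreasing_enum : perm_eq decreasing_enum (enum I).
Proof. by rewrite perm_sort. Qed.

Lemma size_decreasing_enum : size decreasing_enum = #|I|.
Proof. by rewrite (perm_size perm_decreasing_enum) cardE. Qed.

Lemma rearrangement_ge0 : (forall x, 0 <= F x) -> forall i, 0 <= rearrangement i.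
Proof.
move=> F_ge0 i; rewrite /rearrangement.
have [lt_i|le_i] := ltnP i (size (map F decreasing_enum)).
  by have /mapP[x _ ->] := mem_nth 0 lt_i.
by rewrite nth_default.
Qed.

Lemma nonincreasing_rearrangement :
  (forall x, 0 <= F x) -> nonincreasing_seq rearrangement.
Proof.
move=> F_ge0; apply/nonincreasing_seqP => i.
have [lt_i|le_i] := ltnP i.+1 (size (map F decreasing_enum)).
  have : sorted >=%O (map F decreasing_enum).
    by rewrite sorted_map; apply: sort_sorted => x y; exact: le_total.
  by move/(sortedP 0)/(_ _ lt_i).
by rewrite [leLHS]nth_default // rearrangement_ge0.
Qed.

Lemma sum_rearrangement (phi : R -> R) (j : nat) : (j <= #|I|)%N ->
  \sum_(i < j) phi (rearrangement i) =
  \sum_(x <- take j decreasing_enum) phi (F x).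
Proof.
rewrite -size_decreasing_enum => le_j.
rewrite -[RHS](big_map F xpredT) (big_nth 0) size_map size_takel // big_mkord.
by apply: eq_bigr => i _; rewrite map_take nth_take.
Qed.

Lemma ler_sum_sqr_majorized d :
  (forall x, 0 <= F x) -> (forall i, 0 <= d i) -> nonincreasing_seq d ->
  (forall X : {set I}, \sum_(x in X) F x <= \sum_(i < #|X|) d i) ->
  \sum_x F x ^+ 2 <= \sum_(i < #|I|) d i ^+ 2.
Proof.
move=> F_ge0 d_ge0 d_dec le_Fd.
have -> : \sum_x F x ^+ 2 = \sum_(i < #|I|) rearrangement i ^+ 2.
  rewrite (sum_rearrangement (fun y => y ^+ 2)) //.
  rewrite take_oversize ?size_decreasing_enum //.
  by rewrite (perm_big _ perm_decreasing_enum) big_enum.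
apply: ler_sum_sqr_majorized_seq => //.
- exact: rearrangement_ge0.
- exact: nonincreasing_rearrangement.
move=> j le_jI; rewrite (sum_rearrangement id) //.
have uniq_top : uniq (take j decreasing_enum).
  by rewrite take_uniq // (perm_uniq perm_decreasing_enum) enum_uniq.
have card_top : #|[set x in take j decreasing_enum]%SET| = j.
  by rewrite cardsE (card_uniqP uniq_top) size_takel ?size_decreasing_enum.
have := le_Fd [set x in take j decreasing_enum]%SET; rewrite card_top.
apply: le_trans.
by rewrite big_uniq //=; under [leRHS]eq_bigl do rewrite inE.
Qed.

End Majorization.

Section Agreement.
Variables I J J' : finType.
Implicit Types (A : J -> {set I}) (B : J' -> {set I}) (X : {set I}).
Implicit Types (f : J -> I) (g : J' -> I).

Definition picks (L : finType) (A : L -> {set I}) (f : L -> I) (x : I) :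
    {set L} :=
  [set j | (f j == x) && (f j \in A j)]%SET.

Definition hits (L : finType) (A : L -> {set I}) (X : {set I}) : {set L} :=
  [set j | ~~ [disjoint A j & X]]%SET.

Definition agreement A B f g : {set J * J'} :=
  [set p | [&& f p.1 == g p.2, f p.1 \in A p.1 & g p.2 \in B p.2]]%SET.

Lemma sum_card_picks_le A f X : (\sum_(x in X) #|picks A f x| <= #|hits A X|)%N.
Proof.
pose D := [set j | (f j \in X) && (f j \in A j)]%SET.
have -> : (\sum_(x in X) #|picks A f x|)%N = #|D|.
  rewrite -sum1_card (partition_big f (mem X)); last first.
    by move=> j; rewrite inE => /andP[].
  apply: eq_bigr => x xX; rewrite -sum1_card; apply: eq_bigl => j.
  by rewrite !inE; case: eqP => [->|_]; rewrite ?xX ?andbT ?andbF.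
apply/subset_leq_card/fintype.subsetP => j; rewrite !inE => /andP[fX fA].
by apply/pred0Pn; exists (f j); rewrite /= fA.
Qed.

Lemma card_agreement A B f g :
  #|agreement A B f g| = (\sum_x #|picks A f x| * #|picks B g x|)%N.
Proof.
rewrite -sum1_card (partition_big (fun p : J * J' => f p.1) xpredT) //=.
apply: eq_bigr => x _; rewrite -cardsX -sum1_card; apply: eq_bigl => -[i j].
rewrite !inE /=; case: (eqVneq (f i) x) => [->|_]; rewrite ?andbF //.
by rewrite andbT /= andbCA eq_sym; case: (eqVneq (g j) x) => [->|_] //=.
Qed.

End Agreement.

Lemma card_agreement_le (R : realFieldType) (I J J' : finType)
    (A : J -> {set I}) (B : J' -> {set I}) (f : J -> I) (g : J' -> I)
    (d : nat -> nat) :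
  {homo d : i j / (i <= j)%N >-> (j <= i)%N} ->
  (forall X, (#|hits A X| <= \sum_(i < #|X|) d i)%N) ->
  (forall X, (#|hits B X| <= \sum_(i < #|X|) d i)%N) ->
  #|agreement A B f g|%:R <= \sum_(i < #|I|) (d i)%:R ^+ 2 :> R.
Proof.
move=> d_dec hitA hitB.
have sum_sqr_picks (L : finType) (C : L -> {set I}) (h : L -> I) :
    (forall X, (#|hits C X| <= \sum_(i < #|X|) d i)%N) ->
    \sum_x #|picks C h x|%:R ^+ 2 <= \sum_(i < #|I|) (d i)%:R ^+ 2 :> R.
  move=> hitC.
  apply: (@ler_sum_sqr_majorized _ _ _ (fun i => (d i)%:R)) => // [i j|X].
    by rewrite ler_nat; exact: d_dec.
  by rewrite -!natr_sum ler_nat (leq_trans (sum_card_picks_le _ _ _)).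
have AM_GM : #|agreement A B f g|%:R <=
    \sum_x (#|picks A f x|%:R ^+ 2 + #|picks B g x|%:R ^+ 2) / 2 :> R.
  rewrite card_agreement natr_sum; apply: ler_sum => x _.
  by rewrite natrM leif_mean_square.
apply: le_trans AM_GM _; rewrite -mulr_suml big_split /= ler_pdivrMr //.
by rewrite mulr_natr mulr2n lerD // sum_sqr_picks.
Qed.

Lemma bin_sum_hockey_stick (N K x : nat) : (x <= N.+1)%N ->
  'C(N.+1, K.+1) = ('C(N.+1 - x, K.+1) + \sum_(i < x) 'C(N - i, K))%N.
Proof.
elim: x => [|x IHx] lt_xN; first by rewrite subn0 big_ord0 addn0.
rewrite (IHx (ltnW lt_xN)) big_ord_recr /= subSn // subSS binS.
by rewrite -addnA [('C(_, K) + _)%N]addnC.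
Qed.

Lemma bin_sub_mul_expn_le (N K j : nat) : (0 < K)%N ->
  ('C(N - j, K) * N ^ j <= 'C(N, K) * (N - K) ^ j)%N.
Proof.
move=> K_gt0; elim: j => [|j IHj]; first by rewrite subn0.
have ratio_le : ('C(N - j.+1, K) * N <= 'C(N - j, K) * (N - K))%N.
  rewrite subnS; case Nj: (N - j)%N => [|m]; first by rewrite bin0n; lia.
  rewrite -(leq_pmul2l (ltn0Sn m)) [leqLHS]mulnA mul_bin_down mulnAC.
  by rewrite [leqRHS]mulnCA [leqRHS]mulnC leq_mul2r; apply/orP; right; nia.
rewrite !expnS mulnA (leq_trans (leq_mul ratio_le (leqnn _))) //.
by rewrite mulnAC [leqRHS]mulnCA [leqRHS]mulnC leq_mul2r IHj orbT.
Qed.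

Lemma bin_sub_le_geometric (R : realFieldType) (N K j : nat) : (0 < K <= N)%N ->
  'C(N - j, K)%:R <= 'C(N, K)%:R * ((N - K)%:R / N%:R) ^+ j :> R.
Proof.
move=> /andP[K_gt0 le_KN]; have N_gt0 := leq_trans K_gt0 le_KN.
rewrite expr_div_n mulrA ler_pdivlMr ?exprn_gt0 ?ltr0n //.
by rewrite -!natrX -!natrM ler_nat bin_sub_mul_expn_le.
Qed.

Lemma sum_sqr_geometric_le (R : realFieldType) (c q : R) (m : nat) : 0 <= q < 1 ->
  \sum_(i < m) (c * q ^+ i) ^+ 2 <= c ^+ 2 / (1 - q ^+ 2).
Proof.
move=> /andP[q_ge0 q_lt1].
have q2_lt1 : 0 < 1 - q ^+ 2 by rewrite subr_gt0 expr_lt1.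
rewrite ler_pdivlMr //; under eq_bigr do rewrite exprMn exprAC.
rewrite -mulr_sumr -mulrA ler_piMr ?sqr_ge0 // mulrC -opprB mulNr -subrX1 opprB.
by rewrite gerBl !exprn_ge0.
Qed.

(* The sum of the squares of [p * q ^ i]; for [q = 1 - p] it is [p / (2 - p)], but
   as draws are without replacement [q] is slightly larger for them. *)
Definition agreement_bound (R : realFieldType) (p q : R) : R :=
  p ^+ 2 / (1 - q ^+ 2).

Lemma ler_agreement_bound (R : realFieldType) (p p' q q' : R) :
  0 <= p <= p' -> 0 <= q <= q' -> q' < 1 ->
  agreement_bound p q <= agreement_bound p' q'.
Proof.
move=> /andP[p_ge0 le_p] /andP[q_ge0 le_q] q'_lt1.
have q'_ge0 := le_trans q_ge0 le_q; have p'_ge0 := le_trans p_ge0 le_p.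
have den_gt0 : 0 < 1 - q' ^+ 2 by rewrite subr_gt0 expr_lt1.
have le_den : 1 - q' ^+ 2 <= 1 - q ^+ 2 by rewrite lerD2l lerN2 ler_pXn2r.
apply: ler_pM; rewrite ?sqr_ge0 ?ler_pXn2r // ?invr_ge0 ?lef_pV2 ?posrE //.
- exact: ltW (lt_le_trans den_gt0 le_den).
- exact: lt_le_trans den_gt0 le_den.
Qed.

Lemma sum_sqr_bin_le (R : realFieldType) (N K m : nat) : (0 < K <= N)%N ->
  \sum_(i < m) 'C(N - i, K)%:R ^+ 2 <=
    agreement_bound (K.+1%:R / N.+1%:R) ((N - K)%:R / N%:R) *
    'C(N.+1, K.+1)%:R ^+ 2 :> R.
Proof.
move=> K_itv; have /andP[K_gt0 le_KN] := K_itv.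
have N_gt0 : (0 < N)%N := leq_trans K_gt0 le_KN.
set p := K.+1%:R / N.+1%:R; set q := (N - K)%:R / N%:R.
have q_itv : 0 <= q < 1.
  by rewrite divr_ge0 //= ltr_pdivrMr ?ltr0n // mul1r ltr_nat ltn_subrL K_gt0.
have binE : 'C(N, K)%:R = p * 'C(N.+1, K.+1)%:R :> R.
  by rewrite /p mulrAC -natrM -mul_bin_diag natrM mulrAC divff ?mul1r ?pnatr_eq0.
apply: (@le_trans _ _ (\sum_(i < m) ('C(N, K)%:R * q ^+ i) ^+ 2)).
  apply: ler_sum => i _; have le_geo := @bin_sub_le_geometric R N K i K_itv.
  by rewrite ler_sqr ?nnegrE // (le_trans _ le_geo).
apply: le_trans (sum_sqr_geometric_le _ _ q_itv) _.
by rewrite binE exprMn mulrAC.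
Qed.

Section Draws.
Variables (T : finType) (k : nat).

Definition draw := {S : {set T} | #|S| == k}.

Lemma draw_card (S : draw) : #|val S| = k.
Proof. exact/eqP/(valP S). Qed.

Lemma card_draws_disjoint (X : {set T}) :
  #|[set S : draw | [disjoint val S & X]]%SET| = 'C(#|T| - #|X|, k).
Proof.
have -> : (#|T| - #|X|)%N = #|~: X| by rewrite [RHS]cardsCs finset.setCK.
rewrite -cards_draws -(card_imset _ val_inj); apply: eq_card => S.
rewrite !inE -finset.disjoints_subset.
apply/imsetP/andP => [[S' + ->]|[disj cardS]].
  by rewrite inE => disj; split=> //; exact: (valP S').
by exists (exist _ S cardS); rewrite ?inE.
Qed.

Lemma card_draw : #|{: draw}| = 'C(#|T|, k).
Proof. by rewrite card_sig -card_draws cardsE. Qed.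

End Draws.

Lemma disjoint_preimset (aT rT : finType) (h : aT -> rT) (X : {set aT})
    (S : {set rT}) :
  [disjoint h @^-1: S & X] = [disjoint S & h @: X].
Proof.
rewrite disjoint_sym finset.disjoints_subset -preimsetC -sub_imset_pre.
by rewrite -finset.disjoints_subset disjoint_sym.
Qed.

Lemma card_hits_draw (T : finType) (K : nat) (X : {set T}) :
  #|hits (fun S : draw T K.+1 => val S) X| =
  (\sum_(i < #|X|) 'C(#|T|.-1 - i, K))%N.
Proof.
have [T0|T_gt0] := posnP #|T|.
  have noX : #|X| = 0%N by apply/eqP; rewrite -leqn0 -T0 max_card.
  rewrite noX big_ord0; apply/eqP; rewrite -leqn0.
  by rewrite (leq_trans (max_card _)) // card_draw T0.
apply: (@addnI #|~: hits (fun S : draw T K.+1 => val S) X|); rewrite addnC cardsC.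
have -> : #|~: hits (fun S : draw T K.+1 => val S) X| = 'C(#|T| - #|X|, K.+1).
  by rewrite -card_draws_disjoint; apply: eq_card => S; rewrite !inE negbK.
rewrite card_draw -(prednK T_gt0) (bin_sum_hockey_stick K (x := #|X|)) //.
by rewrite prednK ?max_card.
Qed.

(* How [X] is spread over the fibres of [h] is irrelevant, as [h @: X] has at
   most [#|X|] elements: this lets cells of the grid be counted like rows. *)
Lemma card_hits_preimset_draw_le (I T : finType) (K : nat) (h : I -> T)
    (X : {set I}) :
  (#|hits (fun S : draw T K.+1 => h @^-1: val S) X| <=
   \sum_(i < #|X|) 'C(#|T|.-1 - i, K))%N.
Proof.
have -> : hits (fun S : draw T K.+1 => h @^-1: val S) X =
    hits (fun S : draw T K.+1 => val S) (h @: X).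
  by apply/setP => S; rewrite !inE disjoint_preimset.
have le_hX := leq_imset_card h (mem X).
rewrite card_hits_draw (big_ord_widen _ (fun i => 'C(#|T|.-1 - i, K)) le_hX).
by rewrite big_mkcond; apply: leq_sum => i _; case: ifP.
Qed.

Section Grid.
Variables (T : finType) (K : nat).

Definition rows (S : draw T K.+1) : {set T * T} := fst @^-1: val S.

Definition cols (S : draw T K.+1) : {set T * T} := snd @^-1: val S.

Lemma card_rows (S : draw T K.+1) : #|rows S| = (K.+1 * #|T|)%N.
Proof.
have -> : rows S = finset.setX (val S) [set: T]%SET.
  by apply/setP => x; rewrite !inE andbT.
by rewrite cardsX draw_card cardsT.
Qed.

Lemma card_cols (S : draw T K.+1) : #|cols S| = (K.+1 * #|T|)%N.
Proof.
have -> : cols S = finset.setX [set: T]%SET (val S).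
  by apply/setP => x; rewrite !inE.
by rewrite cardsX draw_card cardsT mulnC.
Qed.

Lemma card_rowsI_cols (S S' : draw T K.+1) :
  #|rows S :&: cols S'| = (K.+1 * K.+1)%N.
Proof.
have -> : rows S :&: cols S' = finset.setX (val S) (val S').
  by apply/setP => x; rewrite !inE.
by rewrite cardsX !draw_card.
Qed.

Lemma draw_carrier_gt0 : draw T K.+1 -> (0 < #|T|)%N.
Proof.
by move=> S; rewrite (leq_trans _ (max_card (mem (val S)))) // draw_card.
Qed.

Lemma rows_gt0 (S : draw T K.+1) : (0 < #|rows S|)%N.
Proof. by rewrite card_rows muln_gt0 draw_carrier_gt0. Qed.

Lemma cols_gt0 (S : draw T K.+1) : (0 < #|cols S|)%N.
Proof. by rewrite card_cols muln_gt0 draw_carrier_gt0. Qed.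

Lemma card_agreement_rows_cols_le (R : realFieldType)
    (f g : draw T K.+1 -> T * T) :
  (0 < K < #|T|)%N ->
  #|agreement rows cols f g|%:R <=
    agreement_bound (K.+1%:R / #|T|%:R) ((#|T|.-1 - K)%:R / #|T|.-1%:R) *
    #|{: draw T K.+1 * draw T K.+1}|%:R :> R.
Proof.
move=> /andP[K_gt0 lt_KT]; have T_gt0 : (0 < #|T|)%N by apply: leq_trans lt_KT.
pose d i := 'C(#|T|.-1 - i, K).
have d_dec : {homo d : i j / (i <= j)%N >-> (j <= i)%N}.
  by move=> i j le_ij; rewrite leq_bin2l // leq_sub2l.
have K_itv : (0 < K <= #|T|.-1)%N by rewrite K_gt0 -ltnS prednK.
have hits_rows : forall X, (#|hits rows X| <= \sum_(i < #|X|) d i)%N.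
  exact: (card_hits_preimset_draw_le K fst).
have hits_cols : forall X, (#|hits cols X| <= \sum_(i < #|X|) d i)%N.
  exact: (card_hits_preimset_draw_le K snd).
apply: le_trans (card_agreement_le R f g d_dec hits_rows hits_cols) _.
apply: le_trans (sum_sqr_bin_le _ _ K_itv) _.
by rewrite prednK // card_prod card_draw natrM -expr2.
Qed.

End Grid.

Lemma sumr_mem (R : pzSemiRingType) (I : finType) (A : {set I}) :
  \sum_x (x \in A)%:R = #|A|%:R :> R.
Proof. by rewrite -natr_sum -big_mkcond sum1_card. Qed.

Section Uniform.
Variables (R : realType) (I : finType).
Implicit Types A B : {set I}.

Definition uniform_mass A : {ffun I -> R} := [ffun x => (x \in A)%:R / #|A|%:R].

Lemma uniform_mass_ge0 A (x : I) : 0 <= uniform_mass A x.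
Proof. by rewrite ffunE divr_ge0. Qed.

Lemma uniform_mass_sum1 A : (0 < #|A|)%N -> \sum_x uniform_mass A x = 1.
Proof.
move=> A_gt0; under eq_bigr do rewrite ffunE.
by rewrite -mulr_suml sumr_mem divff // pnatr_eq0 -lt0n.
Qed.

Definition uniform_fdist A (A_gt0 : (0 < #|A|)%N) : fdist R I :=
  FDist (uniform_mass_ge0 A) (uniform_mass_sum1 A_gt0).

Definition supported_in (P : fdist R I) A : Prop :=
  forall x, x \notin A -> P x = 0.

Lemma supported_uniform A (A_gt0 : (0 < #|A|)%N) :
  supported_in (uniform_fdist A_gt0) A.
Proof. by move=> x /negbTE xA; rewrite /= ffunE xA mul0r. Qed.

Lemma dTV_uniform A B (A_gt0 : (0 < #|A|)%N) (B_gt0 : (0 < #|B|)%N) :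
  #|A| = #|B| ->
  dTV (uniform_fdist A_gt0) (uniform_fdist B_gt0) = 1 - #|A :&: B|%:R / #|A|%:R.
Proof.
move=> AB; have A_neq0 : #|A|%:R != 0 :> R by rewrite pnatr_eq0 -lt0n.
have abs_diff x : `|uniform_mass A x - uniform_mass B x| =
    ((x \in A)%:R + (x \in B)%:R - 2 * (x \in A :&: B)%:R) / #|A|%:R.
  rewrite !ffunE -AB -mulrBl normrM normfV normr_nat inE.
  by case: (x \in A); case: (x \in B); congr (_ / _);
    rewrite /= ?subrr ?subr0 ?sub0r ?normrN ?normr0 ?normr1; ring.
rewrite /dTV /= (eq_bigr _ (fun x _ => abs_diff x)).
by rewrite -mulr_suml sumrB big_split /= -mulr_sumr !sumr_mem -AB; field.
Qed.

End Uniform.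

Lemma dTV_rows_cols (R : realType) (T : finType) (K : nat) (S S' : draw T K.+1) :
  dTV (uniform_fdist R (rows_gt0 S)) (uniform_fdist R (cols_gt0 S')) =
  1 - K.+1%:R / #|T|%:R.
Proof.
rewrite dTV_uniform ?card_rows ?card_cols // card_rowsI_cols !natrM -mulf_div.
by rewrite divff ?mul1r // pnatr_eq0.
Qed.

Local Open Scope classical_set_scope.

Section Averaging.
Context (R : realType) (d : measure_display) (T : measurableType d).
Context (Pr : probability T R) (J : finType) (E : J -> set T).
Hypothesis mE : forall j, measurable (E j).

Lemma sum_probability_le (c : R) :
  (forall r, \sum_j \1_(E j) r <= c) -> (\sum_j Pr (E j) <= c%:E)%E.
Proof.
move=> le_c.
have mindic j : measurable_fun setT (EFin \o (\1_(E j) : T -> R)).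
  by apply/measurable_EFinP; exact: measurable_indic.
have indic_ge0 j r : (0 <= (\1_(E j) r : R)%:E)%E by rewrite lee_fin.
have -> : (\sum_j Pr (E j) = \int[Pr]_r \sum_j (\1_(E j) r)%:E)%E.
  rewrite ge0_integral_sum //; apply: eq_bigr => j _.
  by rewrite integral_indic // setIT.
have -> : (c%:E = \int[Pr]_r c%:E)%E.
  by rewrite integral_cst // [X in (_ * X)%E]probability_setT mule1.
apply: ge0_le_integral => //.
- by move=> r _; exact: sume_ge0.
- exact: emeasurable_sum.
- by move=> r _; rewrite sumEFin lee_fin.
Qed.

Lemma exists_probability_le (theta : R) :
  (0 < #|J|)%N -> (forall r, \sum_j \1_(E j) r <= theta * #|J|%:R) ->
  exists j, (Pr (E j) <= theta%:E)%E.
Proof.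
move=> /card_gt0P[j0 _] le_theta; apply: contrapT => /forallNP gt_theta.
have := sum_probability_le le_theta; apply/negP; rewrite -ltNge.
have -> : theta * #|J|%:R = \sum_(j : J) theta by rewrite sumr_const mulr_natr.
have PrE j : Pr (E j) = (fine (Pr (E j)))%:E by rewrite fineK // fin_num_measure.
rewrite (eq_bigr _ (fun j _ => PrE j)) sumEFin lte_fin.
apply: ltr_sum => [|j _]; first by apply/hasP; exists j0; rewrite ?mem_index_enum.
by move/negP: (gt_theta j); rewrite -ltNge PrE lte_fin.
Qed.

End Averaging.

Lemma measurable_finite_rel (I : finType) (J : Type) (d : measure_display)
    (T : measurableType d) (X : T -> I) (Y : T -> J) (D : I -> J -> Prop) :
  (forall A : set I, measurable (X @^-1` A)) ->
  (forall A : set J, measurable (Y @^-1` A)) ->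
  measurable [set r | D (X r) (Y r)].
Proof.
move=> mX mY.
have -> : [set r | D (X r) (Y r)] =
    \bigcup_(x in [set: I]) (X @^-1` [set x] `&` Y @^-1` [set y | D x y]).
  by apply/seteqP; split=> [r Dr|r [x _ [/= -> //]]]; exists (X r).
apply: fin_bigcup_measurable; first exact: finite_finset.
by move=> x _; exact: measurableI.
Qed.

Section Laws.
Context (R : realType) (I : finType) (d : measure_display).
Context (T : measurableType d) (Pr : probability T R).
Implicit Types X Y : T -> I.

Lemma probability_notin_support X (P : fdist R I) (A : {set I}) :
  has_law Pr X P -> supported_in P A -> Pr [set r | X r \notin A] = 0%E.
Proof.
move=> [mX lawX] P0.
have -> : [set r | X r \notin A] =
    \bigcup_(x in [set x | x \notin A]) X @^-1` [set x].
  by apply/seteqP; split=> [r Xr|r [x xA /= -> //]]; exists (X r).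
rewrite measure_fin_bigcup //.
- by apply: fsbig1 => x /P0 Px; rewrite [LHS]lawX Px.
- exact: finite_finset.
- exact: trivIset_preimage1.
Qed.

Lemma disagreement_ge_supports X Y (P Q : fdist R I) (A B : {set I}) :
  has_law Pr X P -> has_law Pr Y Q -> supported_in P A -> supported_in Q B ->
  (1 - Pr [set r | [&& X r == Y r, X r \in A & Y r \in B]]
    <= Pr [set r | X r <> Y r])%E.
Proof.
move=> lawX lawY suppA suppB; have [[mX _] [mY _]] := (lawX, lawY).
have mE :=
  measurable_finite_rel (fun x y => [&& x == y, x \in A & y \in B]) mX mY.
have mD := measurable_finite_rel (fun x y => x <> y) mX mY.
have mXA : measurable [set r | X r \notin A] by exact: (mX [set x | x \notin A]).
have mYB : measurable [set r | Y r \notin B] by exact: (mY [set y | y \notin B]).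
rewrite -probability_setC //.
have <- : Pr ([set r | X r <> Y r] `|` [set r | X r \notin A]
    `|` [set r | Y r \notin B]) = Pr [set r | X r <> Y r].
  have XA0 := probability_notin_support lawX suppA.
  have YB0 := probability_notin_support lawY suppB.
  by rewrite !measureU0 //; exact: measurableU.
apply: le_measure; rewrite ?inE.
- exact: measurableC.
- by apply: measurableU => //; exact: measurableU.
move=> r /= /negP; rewrite !negb_and => /or3P[/eqP|?|?];
  by [left; left|left; right|right].
Qed.

End Laws.

Lemma sum_indic_card (R : pzRingType) (T : Type) (J : finType)
    (D : T -> {set J}) (r : T) :
  \sum_j \1_[set s | j \in D s] r = #|D r|%:R :> R.
Proof.
by rewrite -sumr_mem; apply: eq_bigr => j _; rewrite indicE mem_setE.
Qed.

Lemma exists_disagreement_ge (R : realType) (I J J' : finType)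
    (P : J -> fdist R I) (Q : J' -> fdist R I)
    (A : J -> {set I}) (B : J' -> {set I}) (theta : R)
    (d : measure_display) (T : measurableType d) (Pr : probability T R)
    (f g : fdist R I -> T -> I) :
  (0 < #|J|)%N -> (0 < #|J'|)%N ->
  (forall j, supported_in (P j) (A j)) ->
  (forall j, supported_in (Q j) (B j)) ->
  (forall (u : J -> I) (v : J' -> I),
    #|agreement A B u v|%:R <= theta * #|{: J * J'}|%:R) ->
  correlated_sampling_strategy Pr f g ->
  exists j j', ((1 - theta)%:E <= disagreement Pr f g (P j) (Q j'))%E.
Proof.
move=> J_gt0 J'_gt0 suppP suppQ le_theta [f_law g_law].
pose agree r := agreement A B (fun j => f (P j) r) (fun j => g (Q j) r).
have agreeE p : [set r | p \in agree r] = [set r | [&& f (P p.1) r == g (Q p.2) r,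
    f (P p.1) r \in A p.1 & g (Q p.2) r \in B p.2]].
  by apply/seteqP; split=> r /=; rewrite inE.
have [||r|[j j'] le_agree] := @exists_probability_le R d T Pr (J * J')%type
    (fun p => [set r | p \in agree r]) _ theta.
- move=> p; rewrite agreeE; exact: (measurable_finite_rel
    (fun x y => [&& x == y, x \in A p.1 & y \in B p.2]) (f_law _).1 (g_law _).1).
- by rewrite card_prod muln_gt0 J_gt0.
- by rewrite sum_indic_card le_theta.
exists j, j'; apply: le_trans (disagreement_ge_supports (f_law _) (g_law _)
  (suppP j) (suppQ j')).
by rewrite -(agreeE (j, j')) EFinB leeB.
Qed.

Lemma near_agreement_bound_le (R : realType) (delta gamma : R) :
  0 < delta < 1 -> 0 < gamma ->
  \forall e \near 0^'+, agreement_bound (1 - delta + e) (delta + e) <=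
    (1 - delta) / (1 + delta) + gamma.
Proof.
move=> /andP[delta_gt0 delta_lt1] gamma_gt0.
have bound0 : agreement_bound (1 - delta) delta = (1 - delta) / (1 + delta).
  have -> : agreement_bound (1 - delta) delta =
      (1 - delta) ^+ 2 / ((1 - delta) * (1 + delta)) by congr (_ / _); ring.
  by field; apply/andP; split; lra.
have shift_cvg (c : R) : c + e @[e --> 0^'+] --> c.
  rewrite -[X in _ --> X]addr0; apply: cvgD; first exact: cvg_cst.
  exact/cvg_at_right_filter/cvg_id.
have : agreement_bound (1 - delta + e) (delta + e) @[e --> 0^'+] -->
    agreement_bound (1 - delta) delta.
  apply: cvgM; first exact: (cvgM (shift_cvg _) (shift_cvg _)).
  apply: cvgV; first by rewrite lt0r_neq0 // subr_gt0 expr_lt1 // ltW.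
  by apply: cvgB; [exact: cvg_cst|exact: (cvgM (shift_cvg _) (shift_cvg _))].
by move/cvgr_le; apply; rewrite bound0 ltrDl.
Qed.

Lemma exists_grid_density (R : realType) (c e : R) : 0 < c < 1 -> 0 < e ->
  exists N K : nat, [/\ (0 < K <= N)%N, c <= K.+1%:R / N.+1%:R <= c + e &
    (N - K)%:R / N%:R <= 1 - c + e].
Proof.
move=> /andP[c_gt0 c_lt1] e_gt0.
pose N := Num.bound (e^-1 + c^-1); pose K := Num.truncn (c * N.+1%:R).
have [eV_ge0 cV_ge0] : 0 <= e^-1 /\ 0 <= c^-1 by rewrite !invr_ge0 !ltW.
have N_gt : e^-1 + c^-1 < N%:R by rewrite archi_boundP // addr_ge0.
have eN_gt1 : 1 < e * N%:R.
  by rewrite mulrC -ltr_pdivrMr // mul1r (le_lt_trans _ N_gt) // lerDl.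
have cN_gt1 : 1 < c * N%:R.
  by rewrite mulrC -ltr_pdivrMr // mul1r (le_lt_trans _ N_gt) // lerDr.
have NS : N.+1%:R = N%:R + 1 :> R by rewrite -natr1.
have N_gt0 : 0 < N%:R :> R by nra.
have /andP[K_le K_gt] : K%:R <= c * N.+1%:R < K.+1%:R.
  by rewrite truncn_itv // mulr_ge0 // ltW.
have K_gt0 : (0 < K)%N by rewrite truncn_gt0 NS; lra.
rewrite NS -natr1 in K_le K_gt.
have le_KN : (K <= N)%N by rewrite -ltnS -(ltr_nat R) NS; nra.
exists N, K; rewrite K_gt0 le_KN natrB // NS -natr1; split=> //.
  by rewrite ler_pdivlMr ?ler_pdivrMr; nra.
by rewrite ler_pdivrMr //; nra.
Qed.

Lemma exists_grid_agreement_bound_le (R : realType) (delta gamma : R) :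
  0 < delta < 1 -> 0 < gamma ->
  exists N K : nat, [/\ (0 < K <= N)%N, 1 - K.+1%:R / N.+1%:R <= delta &
    agreement_bound (K.+1%:R / N.+1%:R) ((N - K)%:R / N%:R) <=
      (1 - delta) / (1 + delta) + gamma :> R].
Proof.
move=> delta_itv gamma_gt0; have /andP[delta_gt0 delta_lt1] := delta_itv.
near (0 : R)^'+ => e.
have e_gt0 : 0 < e by near: e; exact: nbhs_right_gt.
have e_lt : e < 1 - delta by near: e; apply: nbhs_right_lt; rewrite subr_gt0.
have c_itv : 0 < 1 - delta < 1 by rewrite subr_gt0 delta_lt1 gtrBl.
have [N [K [K_itv /andP[p_ge p_le] q_le]]] := exists_grid_density c_itv e_gt0.
exists N, K; split=> //; first by rewrite lerBlDr -lerBlDl.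
apply: (@le_trans _ _ (agreement_bound (1 - delta + e) (delta + e))).
  apply: ler_agreement_bound; last by lra.
  - by rewrite divr_ge0.
  - by rewrite divr_ge0 //= (le_trans q_le) //; lra.
near: e; exact: near_agreement_bound_le.
Unshelve. all: by end_near.
Qed.

Unset Implicit Arguments.

Theorem theorem1p3 (R : realType) (delta gamma : R)
    (delta_gt0 : 0 < delta) (delta_lt1 : delta < 1) (gamma_gt0 : 0 < gamma) :
  exists (Omega : finType) (F : set (fdist R Omega * fdist R Omega)),
    (forall P Q : fdist R Omega, F (P, Q) -> dTV P Q <= delta) /\
    (forall (d : measure_display) (T : measurableType d)
        (Pr : probability T R) (f g : fdist R Omega -> T -> Omega),
      correlated_sampling_strategy Pr f g ->
      exists P Q : fdist R Omega, F (P, Q) /\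
        ((2 * delta / (1 + delta) - gamma)%:E <= disagreement Pr f g P Q)%E).
Proof.
have delta_itv : 0 < delta < 1 by rewrite delta_gt0.
have [N [K [/andP[K_gt0 le_KN] dTV_le bound_le]]] :=
  exists_grid_agreement_bound_le delta_itv gamma_gt0.
pose P (S : draw 'I_N.+1 K.+1) := uniform_fdist R (rows_gt0 S).
pose Q (S : draw 'I_N.+1 K.+1) := uniform_fdist R (cols_gt0 S).
exists ('I_N.+1 * 'I_N.+1)%type, [set PQ | exists S S', PQ = (P S, Q S')]; split.
  by move=> _ _ [S [S' [-> ->]]]; rewrite dTV_rows_cols card_ord.
move=> d T Pr f g fg_strategy.
have draw_gt0 : (0 < #|{: draw 'I_N.+1 K.+1}|)%N.
  by rewrite card_draw card_ord bin_gt0.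
have suppP S : supported_in (P S) (rows S) := supported_uniform R (rows_gt0 S).
have suppQ S : supported_in (Q S) (cols S) := supported_uniform R (cols_gt0 S).
have grid_K : (0 < K < #|'I_N.+1|)%N by rewrite card_ord K_gt0.
have [S [S' le_disagreement]] :=
  exists_disagreement_ge draw_gt0 draw_gt0 suppP suppQ (fun u v =>
    card_agreement_rows_cols_le R u v grid_K) fg_strategy.
exists (P S), (Q S'); split; first by exists S, S'.
apply: le_trans le_disagreement; rewrite lee_fin card_ord /=.
have -> : 2 * delta / (1 + delta) = 1 - (1 - delta) / (1 + delta) by field; lra.
by rewrite -addrA -opprD lerD2l lerN2.
Qed.
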